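(* Let $r\ge 4$ and $n\ge 2r+4$, and let $H$ be an $n$-vertex $r$-graph with $\delta_1(H)>\binom{\lfloor\frac{n-1}{2}\rfloor}{r-1}+\lceil\frac{n-1}{2}\rceil$. Then $H$ contains a Berge Hamiltonian cycle.
   Context: An $r$-graph is a simple $r$-uniform hypergraph (a set of $r$-element subsets, the edges, of a vertex set). $\delta_1(H)$ is the minimum over vertices $v$ of the number of edges containing $v$. A Berge cycle of length $t$ consists of $t$ distinct vertices $v_1,\dots,v_t$ (its key vertices) and $t$ distinct edges $e_1,\dots,e_t$ with $\{v_{i-1},v_i\}\subseteq e_i$ for all $i$, indices taken modulo $t$. A Berge Hamiltonian cycle is a Berge cycle whose set of key vertices is the whole vertex set of $H$. *)

(* Defs.v *)
From mathcomp Require Import all_boot.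

Set Implicit Arguments.
Unset Strict Implicit.
Unset Printing Implicit Defensive.

(* A hypergraph on the vertex set T is given by its set of edges. *)
Definition uniform (T : finType) (r : nat) (H : {set {set T}}) : Prop :=
  forall e, e \in H -> #|e| = r.

Definition degree (T : finType) (H : {set {set T}}) (v : T) : nat :=
  #|[set e in H | v \in e]|.

(* No degree exceeds #|H|, so the starting value #|H| does not affect the
   minimum as soon as T is nonempty (see min_degreeP). *)
Definition min_degree (T : finType) (H : {set {set T}}) : nat :=
  \big[minn/#|H|]_(v : T) degree H v.

Lemma min_degreeP (T : finType) (H : {set {set T}}) (x : T) :
  (forall v, min_degree H <= degree H v) /\
  (exists v, min_degree H = degree H v).
Proof.
have dle v : degree H v <= #|H|.
  by apply: subset_leq_card; apply/subsetP => e; rewrite inE => /andP[].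
have lb v : min_degree H <= degree H v.
  rewrite /min_degree; have := mem_index_enum v.
  elim: (index_enum T) => // y s IH; rewrite big_cons inE.
  by case/orP=> [/eqP<-|/IH h]; rewrite geq_min ?leqnn // h orbT.
split=> //.
have : (exists v, min_degree H = degree H v) \/ min_degree H = #|H|.
  rewrite /min_degree; apply: (big_ind (fun m => (exists v, m = degree H v) \/ m = #|H|)).
  - by right.
  - by move=> a b ha hb; rewrite /minn; case: ifP.
  - by move=> v _; left; exists v.
case=> // eH; exists x; apply/eqP; rewrite eqn_leq lb /= eH; exact: dle.
Qed.

(* ord_pred is the cyclic predecessor i |-> i - 1 mod t on 'I_t. *)
Definition berge_cycle (T : finType) (H : {set {set T}}) (t : nat)
    (v : 'I_t -> T) (e : 'I_t -> {set T}) : Prop :=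
  [/\ injective v, injective e, forall i, e i \in H
    & forall i, [set v (ord_pred i); v i] \subset e i].

Definition berge_hamiltonian_cycle (T : finType) (H : {set {set T}}) (t : nat)
    (v : 'I_t -> T) (e : 'I_t -> {set T}) : Prop :=
  berge_cycle H v e /\ [set v i | i : 'I_t] = [set: T].

(* Main.v *)
(* A Berge path v_0, ..., v_(t-1) that no unused edge extends can be closed.
   Let X (resp. Y) be the set of i such that v_(i+1) (resp. v_i) lies together
   with v_0 (resp. v_(t-1)) in an edge not used by the path, and let A (resp. B)
   be the set of i such that v_0 (resp. v_(t-1)) lies in the path edge e_i.
   Then deg v_0 <= C(|X|, r-1) + |A| and deg v_(t-1) <= C(|Y|, r-1) + |B|.
   If no cycle on the same t vertices arises by the usual crossing exchange,
   A :|: X is disjoint from Y and B is disjoint from X; here the exchange may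
   reuse the deleted edge e_i itself.  With k = floor((n-1)/2) and
   m = ceil((n-1)/2): if |Y| > k, then |A :|: X| < m and deg v_0 is too small;
   if |Y| <= k, then |B| > m, so |X| < k, and deg v_0 is again too small because
   C(k-1, r-2) >= k.  A cycle missing some vertex extends to a longer path,
   since otherwise its vertex set or the complement would carry a vertex of
   degree at most C(k, r-1). *)
Require Import Defs.
From mathcomp Require Import all_boot.
From mathcomp Require Import zify.

Set Implicit Arguments.
Unset Strict Implicit.
Unset Printing Implicit Defensive.

(** Induction on [a] through Pascal's rule: one summand exceeds [a - 1] by induction and the other
    is positive. The base case is [C(4, 2) = 6]. *)
Lemma ltn_bin_middle a j : 2 <= j -> j + 2 <= a -> a < 'C(a, j).
Proof.
elim: a j => [|a IH] [|j] // j2 ja.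
rewrite binS; case: (ltnP j.+1 a.-1) => h.
  have := IH j.+1; have : 0 < 'C(a, j) by rewrite bin_gt0; lia.
  lia.
case: (ltnP 1 j) => j1.
  have := IH j; have : 0 < 'C(a, j.+1) by rewrite bin_gt0; lia.
  lia.
have -> : j = 1 by lia.
by have -> : a = 3 by lia.
Qed.

(** * Berge paths and cycles: extension, crossing exchange, rotation, closing *)

Section BergePaths.
Variables (T : finType) (H : {set {set T}}).
Implicit Types (v : nat -> T) (e : nat -> {set T}) (x y : T).

(* v 0, ..., v (t-1) are the vertices and e 0, ..., e (t-2) the edges; values
   at larger indices are irrelevant. *)
Definition berge_path t v e : Prop :=
  [/\ forall i j, i < t -> j < t -> v i = v j -> i = j,
      forall i j, i.+1 < t -> j.+1 < t -> e i = e j -> i = j,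
      forall i, i.+1 < t -> e i \in H
    & forall i, i.+1 < t -> v i \in e i /\ v i.+1 \in e i].

Definition closing_edge t v e (f : {set T}) : Prop :=
  [/\ f \in H, forall i, i.+1 < t -> e i <> f, v 0 \in f & v t.-1 \in f].

Lemma berge_path_rev t v e : berge_path t v e ->
  berge_path t (fun j => v (t.-1 - j)) (fun j => e (t.-2 - j)).
Proof.
case=> vI eI eH vE; split.
- by move=> i j it jt /vI; lia.
- by move=> i j it jt /eI; lia.
- by move=> i it; apply: eH; lia.
- move=> i it; have [|h1 h2] := vE (t.-2 - i); first lia.
  have -> : t.-1 - i = (t.-2 - i).+1 by lia.
  by have -> : t.-1 - i.+1 = t.-2 - i by lia.
Qed.

Lemma berge_path_extend t v e h w : 0 < t -> berge_path t v e ->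
  h \in H -> (forall i, i.+1 < t -> e i <> h) -> (forall i, i < t -> v i <> w) ->
  v t.-1 \in h -> w \in h ->
  berge_path t.+1 (fun j => if j < t then v j else w)
                  (fun j => if j.+1 < t then e j else h).
Proof.
move=> t0 [vI eI eH vE] hH he hw vh wh; split.
- move=> i j it jt; case: ltnP => i'; case: ltnP => j'.
  + exact: vI.
  + by move/hw => /(_ i').
  + by move/esym/hw => /(_ j').
  + lia.
- move=> i j it jt; case: ltnP => i'; case: ltnP => j'.
  + exact: eI.
  + by move/he => /(_ i').
  + by move/esym/he => /(_ j').
  + lia.
- by move=> i it; case: ltnP => i' //; apply: eH.
- move=> i it; have -> : i < t by lia.
  case: ltnP => i'; first exact: vE.
  by have -> : i = t.-1 by lia.
Qed.

(** Drop [e i]: go from [v 0] up to [v i], through [g] to [v t.-1], back down to [v i.+1], and close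
    by [f]. The edge condition skips index [i], so [f] or [g] may be [e i]. *)
Lemma berge_path_crossing t v e i f g : i.+1 < t -> berge_path t v e ->
  f \in H -> g \in H -> f <> g ->
  (forall j, j.+1 < t -> j <> i -> e j <> f /\ e j <> g) ->
  v 0 \in f -> v i.+1 \in f -> v i \in g -> v t.-1 \in g ->
  exists v' e', berge_path t v' e' /\ closing_edge t v' e' f.
Proof.
move=> it [vI eI eH vE] fH gH fg efg v0f vif vig vtg.
(* As [j] runs from [i + 1] to [t - 1], the index [t + i - j] runs down from [t - 1] to [i + 1]. *)
exists (fun j => if j <= i then v j else v (t + i - j)).
exists (fun j => if j < i then e j else if j == i then g else e (t + i - j).-1).
split; last first.
  split=> //.
    move=> j jt; case: ltnP => ji; first by apply: (efg j _ _).1; lia.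
    case: eqP => ji'; first by move/esym.
    by apply: (efg _ _ _).1; lia.
  case: leqP => ti; first by have -> : t.-1 = i.+1 by lia.
  by have -> : t + i - t.-1 = i.+1 by lia.
split.
- by move=> a b at_ bt; case: leqP => ai; case: leqP => bi /vI; lia.
- move=> a b at_ bt.
  case: ltnP => ai; case: ltnP => bi.
  + by apply: eI; lia.
  + case: eqP => bi'; last by move/eI; lia.
    by move=> h; case: (efg a) => //; lia.
  + case: eqP => ai'; last by move/eI; lia.
    by move/esym => h; case: (efg b) => //; lia.
  + case: eqP => ai'; case: eqP => bi'; first lia.
    * by move/esym => h; case: (efg (t + i - b).-1) => //; lia.
    * by move=> h; case: (efg (t + i - a).-1) => //; lia.
    * by move/eI; lia.
- move=> a at_; case: ltnP => ai; first by apply: eH; lia.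
  by case: eqP => ai' //; apply: eH; lia.
- move=> a at_; case: (ltngtP a i) => ai.
  + exact: vE.
  + have [|h1 h2] := vE (t + i - a).-1; first lia.
    split; last by have -> : t + i - a.+1 = (t + i - a).-1 by lia.
    by have -> : t + i - a = (t + i - a).-1.+1 by lia.
  + by rewrite ai; have -> : t + i - i.+1 = t.-1 by lia.
Qed.

(** Opening the cycle after [v q] drops the edge that follows [v q]; hence [h] may be that edge,
    namely [e q], or [f] when [q = t - 1]. *)
Lemma berge_cycle_extend t v e f h w q : q < t -> berge_path t v e ->
  closing_edge t v e f -> h \in H -> v q \in h -> w \in h ->
  (forall i, i < t -> v i <> w) ->
  (forall i, i.+1 < t -> i <> q -> e i <> h) -> (q.+1 < t -> f <> h) ->
  exists v' e', berge_path t.+1 v' e'.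
Proof.
move=> qt [vI eI eH vE] [fH ef v0f vtf] hH vqh wh hw heh hfh.
(* Rotate the cycle so that v q becomes the last vertex of a path. *)
pose rot j := if q.+1 + j < t then q.+1 + j else q.+1 + j - t.
have rotP j : rot j = q.+1 + j /\ q.+1 + j < t \/ rot j + t = q.+1 + j.
  by rewrite /rot; case: ltnP => ?; lia.
pose v' j := v (rot j).
pose e' j := if (rot j).+1 < t then e (rot j) else f.
have vt' : v' t.-1 = v q by congr v; have := rotP t.-1; lia.
have P : berge_path t v' e'.
  split.
  - by move=> i j it jt /vI; have := rotP i; have := rotP j; lia.
  - move=> i j it jt; rewrite /e'; have := rotP i; have := rotP j => Rj Ri.
    case: ltnP => ri; case: ltnP => rj.
    + by move/eI; lia.
    + by move/ef => /(_ ri).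
    + by move/esym/ef => /(_ rj).
    + lia.
  - by move=> i it; rewrite /e'; case: ltnP => // ri; apply: eH.
  - move=> i it; rewrite /e' /v'; have := rotP i; have := rotP i.+1 => Ri' Ri.
    case: ltnP => ri.
      have -> : rot i.+1 = (rot i).+1 by lia.
      exact: vE.
    have -> : rot i = t.-1 by lia.
    by have -> : rot i.+1 = 0 by lia.
eexists; eexists; apply: (berge_path_extend (h := h) (w := w) _ P) => //.
- lia.
- move=> i it; rewrite /e'; have := rotP i => Ri; case: ltnP => ri.
    by apply: heh => //; lia.
  by apply: hfh; lia.
- by move=> i it; apply: hw; have := rotP i; lia.
- by rewrite vt'.
Qed.

Lemma berge_path_closing t v e f : t = #|T| -> 0 < t -> berge_path t v e ->
  closing_edge t v e f ->
  exists (s : nat) (v' : 'I_s -> T) (e' : 'I_s -> {set T}),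
    berge_hamiltonian_cycle H v' e'.
Proof.
move=> tn t0 [vI eI eH vE] [fH ef v0f vtf].
have predE (i : 'I_t) : (ord_pred i : nat) = if i == 0 :> nat then t.-1 else i.-1.
  rewrite /=; case: eqP => [->|]; first by rewrite add0n modn_small //; lia.
  move=> i0; have -> : (i + t).-1 = i.-1 + t by lia.
  by rewrite modnDr modn_small //; have := ltn_ord i; lia.
have vI' : injective (fun i : 'I_t => v i).
  by move=> i j /vI h; apply: val_inj; apply: h.
(* The cycle edge of index [i] joins [i - 1] to [i], so path edges shift by one and [f] takes index
   0. *)
exists t, (fun i => v i), (fun i => if i == 0 :> nat then f else e i.-1).
split; last first.
  apply/eqP; rewrite eqEcard subsetT /= cardsT card_imset //.
  by rewrite card_ord tn.
split=> //.
- move=> i j; have := ltn_ord i; have := ltn_ord j => jt it.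
  case: eqP => i0; case: eqP => j0.
  + by move=> _; apply: val_inj; rewrite /= i0 j0.
  + by move/esym/ef; lia.
  + by move/ef; lia.
  + by move/eI => h; apply: val_inj => /=; lia.
- by move=> i; case: eqP => // i0; apply: eH; have := ltn_ord i; lia.
- move=> i; rewrite predE; case: eqP => [->|i0]; apply/subsetP => x.
    by rewrite !inE => /orP[]/eqP->.
  have [|h1 h2] := vE i.-1; first by have := ltn_ord i; lia.
  rewrite !inE => /orP[]/eqP-> //; move: h2.
  by rewrite prednK //; lia.
Qed.

(** * Degree estimates *)

(** Deleting [x] is injective on edges through [x] and yields [(r - 1)]-subsets of [S]. *)
Lemma card_link_leq r x (S : {set T}) : uniform r H ->
  #|[set h in H | (x \in h) && (h :\ x \subset S)]| <= 'C(#|S|, r - 1).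
Proof.
move=> Hr; rewrite -cards_draws -[X in X <= _](card_in_imset (f := fun h => h :\ x)).
  apply/subset_leq_card/subsetP => _ /imsetP[h + ->].
  rewrite !inE => /and3P[hH xh ->] /=.
  by have := cardsD1 x h; rewrite xh (Hr _ hH); lia.
move=> h1 h2; rewrite !inE => /and3P[_ x1 _] /and3P[_ x2 _] h12.
by rewrite -(setD1K x1) -(setD1K x2) h12.
Qed.

Lemma degree_split_leq r x (E : {set {set T}}) (S : {set T}) : uniform r H ->
  (forall h y, h \in H -> h \notin E -> x \in h -> y \in h -> y != x -> y \in S) ->
  degree H x <= #|[set h in E | x \in h]| + 'C(#|S|, r - 1).
Proof.
move=> Hr hS; apply: leq_trans (leq_add (leqnn _) (card_link_leq x S Hr)).
apply: leq_trans (leq_card_setU _ _).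
apply/subset_leq_card/subsetP => h; rewrite !inE => /andP[hH xh].
rewrite hH xh !andbT /=; case: (boolP (h \in E)) => //= hE.
by apply/subsetP => y; rewrite !inE => /andP[yx yh]; exact: (hS h).
Qed.

Lemma unclosed_path_degrees r t v e : 0 < t -> uniform r H -> berge_path t v e ->
  (exists v' e', berge_path t.+1 v' e')
  \/ (exists v' e' f, berge_path t v' e' /\ closing_edge t v' e' f)
  \/ exists A B X Y : {set 'I_t.-1},
       [/\ degree H (v 0) <= #|A| + 'C(#|X|, r - 1),
           degree H (v t.-1) <= #|B| + 'C(#|Y|, r - 1),
           [disjoint A :|: X & Y] & [disjoint B & X]].
Proof.
move=> t0 Hr P; have [vI eI eH vE] := P.
pose E := [set e i | i : 'I_t.-1].
have EP i h : h \notin E -> i.+1 < t -> e i <> h.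
  move=> hE it eh; have it' : i < t.-1 by lia.
  by case/negP: hE; apply/imsetP; exists (Ordinal it').
pose V := [set v i | i : 'I_t].
have VP i w : w \notin V -> i < t -> v i <> w.
  by move=> wV it vw; case/negP: wV; apply/imsetP; exists (Ordinal it).
have [/exists_inP[h]|/exists_inPn no_f] :=
    boolP [exists h in H, [&& h \notin E, v 0 \in h & ~~ (h \subset V)]].
  move=> hH /and3P[hE v0h /subsetPn[w wh wV]]; left.
  eexists; eexists.
  (* An exit at [v 0] extends the reversed path. *)
  apply: (berge_path_extend (h := h) (w := w) t0 (berge_path_rev P)) => //.
  - by move=> i it; apply: EP => //; lia.
  - by move=> i it; apply: VP => //; lia.
  - by rewrite subnn.
have [/exists_inP[h]|/exists_inPn no_l] :=
    boolP [exists h in H, [&& h \notin E, v t.-1 \in h & ~~ (h \subset V)]].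
  move=> hH /and3P[hE vth /subsetPn[w wh wV]]; left.
  eexists; eexists; apply: (berge_path_extend (h := h) (w := w) t0 P) => //.
  - by move=> i it; apply: EP => //; lia.
  - by move=> i it; apply: VP => //; lia.
right.
have [/exists_inP[h]|/exists_inPn no_c] :=
    boolP [exists h in H, [&& h \notin E, v 0 \in h & v t.-1 \in h]].
  move=> hH /and3P[hE v0h vth]; left; exists v, e, h; split=> //; split=> //.
  by move=> i it; apply: EP => //; lia.
pose cross (i : 'I_t.-1) f g := [&& [&& f \in H, g \in H & f != g],
  (f \notin E) || (f == e i), (g \notin E) || (g == e i)
  & [&& v 0 \in f, v i.+1 \in f, v i \in g & v t.-1 \in g]].
have [/existsP[i /existsP[f /existsP[g]]]|no_x] :=
    boolP [exists i, exists f, exists g, cross i f g].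
  case/and4P=> /and3P[fH gH /eqP fg] fE gE /and4P[v0f vif vig vtg]; left.
  have it : i.+1 < t by have := ltn_ord i; lia.
  case: (berge_path_crossing it P fH gH fg _ v0f vif vig vtg); last first.
    by move=> v' [e' h]; exists v', e', f.
  move=> j jt ji; split.
    case/orP: fE => [fE|/eqP->]; first exact: EP.
    by move/eI => h; apply: ji; apply: h.
  case/orP: gE => [gE|/eqP->]; first exact: EP.
  by move/eI => h; apply: ji; apply: h.
right.
have cN (i : 'I_t.-1) f g : f \in H -> g \in H -> f != g ->
    (f \notin E) || (f == e i) -> (g \notin E) || (g == e i) ->
    v 0 \in f -> v i.+1 \in f -> v i \in g -> v t.-1 \in g -> False.
  move=> fH gH fg fE gE v0f vif vig vtg; case/negP: no_x.
  apply/existsP; exists i; apply/existsP; exists f; apply/existsP; exists g.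
  by rewrite /cross fH gH fg fE gE v0f vif vig.
pose nb x y := [exists h in H, [&& h \notin E, x \in h & y \in h]].
pose A := [set i : 'I_t.-1 | v 0 \in e i].
pose B := [set i : 'I_t.-1 | v t.-1 \in e i].
(* [X] stores the index before that of the neighbour, so a common index [i] of [X] and [Y] is
   exactly a crossing at [e i]. *)
pose X := [set i : 'I_t.-1 | nb (v 0) (v i.+1)].
pose Y := [set i : 'I_t.-1 | nb (v t.-1) (v i)].
have eP (i : 'I_t.-1) : [/\ e i \in H, e i \in E, v i \in e i & v i.+1 \in e i].
  have it : i.+1 < t by have := ltn_ord i; lia.
  have [? ?] := vE i it.
  by split=> //; [exact: eH | apply/imsetP; exists i].
have cardE x : #|[set h in E | x \in h]| <= #|[set i : 'I_t.-1 | x \in e i]|.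
  apply: leq_trans (leq_imset_card (fun i : 'I_t.-1 => e i) _).
  apply/subset_leq_card/subsetP => h; rewrite inE => /andP[/imsetP[i _ ->] xi].
  by apply/imsetP; exists i; rewrite ?inE.
exists A, B, X, Y; split.
- apply: (@leq_trans (#|[set h in E | v 0 \in h]| +
                      'C(#|[set v (i : 'I_t.-1).+1 | i in X]|, r - 1))).
    apply: degree_split_leq => // h y hH hE xh yh yx.
    have := no_f h hH; rewrite hE xh /= negbK => /subsetP/(_ y yh) /imsetP[i _ yi].
    have i0 : 0 < i by rewrite lt0n; apply: contra yx => /eqP i0; rewrite yi i0.
    have it : i.-1 < t.-1 by have := ltn_ord i; lia.
    apply/imsetP; exists (Ordinal it); rewrite ?inE /= prednK //.
    by apply/exists_inP; exists h; rewrite // hE xh -yi.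
  by apply: leq_add (cardE _) _; apply: leq_bin2l; apply: leq_imset_card.
- apply: (@leq_trans (#|[set h in E | v t.-1 \in h]| +
                      'C(#|[set v (i : 'I_t.-1) | i in Y]|, r - 1))).
    apply: degree_split_leq => // h y hH hE xh yh yx.
    have := no_l h hH; rewrite hE xh /= negbK => /subsetP/(_ y yh) /imsetP[i _ yi].
    have it : i < t.-1.
      have : i <> t.-1 :> nat by move=> it; case/negP: yx; rewrite yi it.
      by have := ltn_ord i; lia.
    apply/imsetP; exists (Ordinal it); rewrite ?inE //=.
    by apply/exists_inP; exists h; rewrite // hE xh -yi.
  by apply: leq_add (cardE _) _; apply: leq_bin2l; apply: leq_imset_card.
- rewrite disjoint_subset; apply/subsetP => i; rewrite !inE => AX.
  apply/negP => /exists_inP[g gH /and3P[gE vtg vig]].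
  have [eiH eiE vi vi1] := eP i.
  (* For [i] in [A], the edge [e i] itself serves as [f], since it contains [v i.+1]; for [i] in [B]
     it serves below as [g], since it contains [v i]. *)
  case/orP: AX => [v0i | /exists_inP[f fH /and3P[fE v0f vif]]].
    apply: (cN i (e i) g); rewrite ?eqxx ?gE ?orbT //.
    by apply: contraNneq gE => <-.
  apply: (cN i f g); rewrite ?fE ?gE //.
  by apply: contraNneq (no_c f fH) => fg; rewrite fE v0f fg.
- rewrite disjoint_subset; apply/subsetP => i; rewrite !inE => vti.
  apply/negP => /exists_inP[f fH /and3P[fE v0f vif]].
  have [eiH eiE vi vi1] := eP i.
  apply: (cN i f (e i)); rewrite ?eqxx ?fE ?orbT //.
  by apply: contraNneq fE => ->.
Qed.

(** If no edge meets both the cycle and its complement, all edges at a vertex stay on its side,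
    which then has more than [k + 1] vertices by the degree bound; two such sides exceed [#|T|]. *)
Lemma berge_cycle_grow r t v e f k : 0 < t -> t < #|T| -> #|T| <= k.+1.*2 ->
  uniform r H -> (forall x, 'C(k, r - 1) < degree H x) ->
  berge_path t v e -> closing_edge t v e f -> exists v' e', berge_path t.+1 v' e'.
Proof.
move=> t0 tn nk Hr Hd P C; have [vI eI _ vE] := P; have [_ ef _ vtf] := C.
pose V := [set v i | i : 'I_t].
have VP i w : w \notin V -> i < t -> v i <> w.
  by move=> wV it vw; case/negP: wV; apply/imsetP; exists (Ordinal it).
have cV : #|V| = t.
  by rewrite card_imset ?card_ord // => i j /vI h; apply: val_inj; apply: h.
have [/exists_inP[h hH /andP[/subsetPn[w wh wV] /subsetPn[y yh]]]|/exists_inPn no_h] :=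
    boolP [exists h in H, ~~ (h \subset V) && ~~ (h \subset ~: V)].
  rewrite !inE negbK => /imsetP[p _ yp].
  have hw i : i < t -> v i <> w by apply: VP.
  (* If [h] lies on the cycle, the vertex just before it is taken as [v q]; otherwise any cycle
     vertex in [h] serves. *)
  have [/existsP[q /eqP eqh]|/existsPn ne] := boolP [exists q : 'I_t.-1, e q == h].
    have qt := ltn_ord q; have [|vq _] := vE q; first lia.
    apply: (berge_cycle_extend (q := q) (h := h) (w := w) _ P C) => //.
    - lia.
    - by rewrite -eqh.
    - by move=> i it iq; rewrite -eqh => /eI; lia.
    - by move=> ?; rewrite -eqh; apply/nesym/ef; lia.
  have ne' i : i.+1 < t -> e i <> h.
    by move=> it; have it' : i < t.-1 by [lia]; apply/eqP; apply: (ne (Ordinal it')).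
  have [fh|/eqP fh] := eqVneq f h.
    apply: (berge_cycle_extend (q := t.-1) (h := h) (w := w) _ P C) => //; try lia.
    - by rewrite -fh.
    - by move=> i it _; apply: ne'.
  apply: (berge_cycle_extend (q := p) (h := h) (w := w) _ P C) => //.
  - by rewrite -yp.
  - by move=> i it _; apply: ne'.
have bound x (S : {set T}) : x \in S ->
    (forall h, h \in H -> x \in h -> h \subset S) -> k.+1 < #|S|.
  move=> xS hS; rewrite ltnNge; apply/negP => Sk.
  have := Hd x; rewrite ltnNge => /negP; apply.
  have := @degree_split_leq r x set0 (S :\ x) Hr.
  have -> : [set h : {set T} in set0 | x \in h] = set0.
    by apply/setP => h; rewrite !inE.
  rewrite cards0 => le; apply: leq_trans (le _) _.
    by move=> h y hH _ xh yh yx; rewrite !inE yx; apply: (subsetP (hS h hH xh)).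
  by apply: leq_bin2l; have := cardsD1 x S; rewrite xS; lia.
have b1 : k.+1 < #|V|.
  have v0V : v 0 \in V by apply/imsetP; exists (Ordinal t0).
  apply: (bound (v 0)) => // h hH vh; have := no_h h hH.
  by rewrite negb_and !negbK => /orP[//|/subsetP/(_ _ vh)]; rewrite inE v0V.
have [w wV] : exists w, w \in ~: V.
  by apply/set0Pn; rewrite -card_gt0 cardsCs setCK cV; lia.
have : k.+1 < #|~: V|.
  apply: (bound w) => // h hH wh; have := no_h h hH.
  rewrite negb_and !negbK => /orP[/subsetP/(_ _ wh) wV'|//].
  by move: wV; rewrite inE wV'.
by have := cardsC V; lia.
Qed.

End BergePaths.

(** * Numerical contradiction and growth to a Hamiltonian cycle *)

Theorem theorem1p8 (r n : nat) (T : finType) (H : {set {set T}}) :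
  4 <= r -> 2 * r + 4 <= n -> #|T| = n -> uniform r H ->
  min_degree H > 'C((n - 1)./2, r - 1) + uphalf (n - 1) ->
  exists (t : nat) (v : 'I_t -> T) (e : 'I_t -> {set T}),
    berge_hamiltonian_cycle H v e.
Proof.
move=> r4 rn Tn Hr; set k := (n - 1)./2; set m := uphalf (n - 1) => Hmin.
have km : k + m = n - 1 by rewrite /k /m; lia.
have kr : r < k by rewrite /k; lia.
have mk : m <= k.+1 by rewrite /m /k; lia.
have [x0 _] : exists x, x \in T by apply/card_gt0P; rewrite Tn; lia.
have [lb _] := min_degreeP H x0.
have Hd x : 'C(k, r - 1) + m < degree H x by exact: leq_trans Hmin (lb x).
have path_leq t v e : berge_path H t v e -> t <= n.
  case=> vI _ _ _; rewrite -Tn -(card_ord t) -(@card_imset _ _ (fun i : 'I_t => v i)).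
    exact: max_card.
  by move=> i j /vI h; apply: val_inj; apply: h.
(* Pascal's rule with [C(k - 1, r - 2) >= k], where [4 <= r] and [r < k] are the bounds required. *)
have binB : 'C(k.-1, r - 1) + k <= 'C(k, r - 1).
  have -> : k = k.-1.+1 by lia.
  have -> : r - 1 = (r - 2).+1 by lia.
  by rewrite binS /= leq_add2l; apply: ltn_bin_middle; lia.
have step t v e : 0 < t -> berge_path H t v e ->
    (exists v' e', berge_path H t.+1 v' e') \/
    exists v' e' f, berge_path H t v' e' /\ closing_edge H t v' e' f.
  move=> t0 P; have tn := path_leq _ _ _ P.
  have card_disj (Q S : {set 'I_t.-1}) : [disjoint Q & S] -> #|Q| + #|S| <= t.-1.
    move=> /disjoint_setI0 QS; rewrite -cardsUI QS cards0 addn0.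
    by rewrite -[X in _ <= X]card_ord max_card.
  case: (unclosed_path_degrees t0 Hr P) => [|[|[A [B [X [Y []]]]]]].
  - by left.
  - by right.
  move=> dA dB /card_disj AXY /card_disj BX.
  have := Hd (v 0); have := Hd (v t.-1) => dB' dA'.
  have AAX := subset_leq_card (subsetUl A X).
  have XAX := subset_leq_card (subsetUr A X).
  (* In the first case [#|A| <= n - 1 = k + m], and [binB] absorbs the surplus [k] because
     [#|X| <= k - 1]; in the second, [#|X| < m <= k + 1]. *)
  case: (leqP #|Y| k) => Yk.
    have := leq_bin2l (r - 1) Yk => CY.
    have Xk : #|X| <= k.-1 by lia.
    have := leq_bin2l (r - 1) Xk; lia.
  have Xk : #|X| <= k by lia.
  have := leq_bin2l (r - 1) Xk; lia.
(* Induction on a strict bound [d] for [n - t], the number of vertices off the path. *)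
have main d t v e : n - t < d -> 0 < t -> berge_path H t v e ->
    exists (t : nat) (v : 'I_t -> T) (e : 'I_t -> {set T}),
      berge_hamiltonian_cycle H v e.
  elim: d t v e => [|d IH] t v e // td t0 P; have tn := path_leq _ _ _ P.
  have grow : (exists v' e', berge_path H t.+1 v' e') ->
      exists (t : nat) (v : 'I_t -> T) (e : 'I_t -> {set T}),
        berge_hamiltonian_cycle H v e.
    by case=> v' [e' P']; have := path_leq _ _ _ P'; move: P' => /IH h ?; apply: h; lia.
  case: (step _ _ _ t0 P) => [/grow//|[v' [e' [f [P' C]]]]].
  case: (ltnP t n) => [tn'|nt]; last by apply: berge_path_closing P' C; lia.
  apply: grow; apply: (berge_cycle_grow (k := k) t0 _ _ Hr _ P' C); first lia.
    by rewrite Tn /k; lia.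
  by move=> x; have := Hd x; lia.
(* A single vertex is a path without edges; [set0] is a filler value. *)
apply: (main n.+1 1 (fun=> x0) (fun=> set0)) => //; first lia.
by split=> // i j; lia.
Qed.
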